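(* Let $K$ be a finite field with $q$ elements, let $s\geq 1$, and let $w_1,\dots,w_s$ be positive integers with $\gcd(w_1,\dots,w_s)=1$. Let $I_{\mathbb{T}}\subset K[t_1,\dots,t_s]$ be the vanishing ideal of the weighted projective torus $\mathbb{T}(w_1,\dots,w_s)$, and let $\mathsf{g}_Q$ be the Frobenius number of the numerical semigroup $Q=\langle w_1,\dots,w_s\rangle\subset\mathbb{N}$ (with the convention $\mathsf{g}_Q=-1$ if $Q=\mathbb{N}$). Then the index of regularity of $K[t_1,\dots,t_s]/I_{\mathbb{T}}$ is $$(q-2)\Bigl(\sum_{i=1}^s w_i+\mathsf{g}_Q\Bigr)+\mathsf{g}_Q+1.$$
   Context: $\mathbb{N}=\{0,1,2,\dots\}$. The weighted projective space $\mathbb{P}(w_1,\dots,w_s)$ is the quotient $(K^s\setminus 0)/K^*$, where $\lambda\in K^*$ acts by $\lambda(x_1,\dots,x_s)=(\lambda^{w_1}x_1,\dots,\lambda^{w_s}x_s)$. The weighted projective torus is $\mathbb{T}(w_1,\dots,w_s)=\{(x_1,\dots,x_s)\in\mathbb{P}(w_1,\dots,w_s): x_1\cdots x_s\neq 0\}$. The polynomial ring $K[t_1,\dots,t_s]$ is graded by $\deg(t_i)=w_i$. The vanishing ideal of a set $X\subset\mathbb{P}(w_1,\dots,w_s)$ is the ideal of $K[t_1,\dots,t_s]$ generated by all homogeneous polynomials (for this grading) that vanish on $X$. $Q=\langle w_1,\dots,w_s\rangle$ is the submonoid of $\mathbb{N}$ generated by $w_1,\dots,w_s$; since $\gcd(w_1,\dots,w_s)=1$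 its complement $\mathbb{N}\setminus Q$ is finite, and the Frobenius number is $\mathsf{g}_Q=\max(\mathbb{N}\setminus Q)$. For a finitely generated graded $K[t_1,\dots,t_s]$-module $M$, the Hilbert function is $\varphi_M(d)=\dim_K M_d$. It is quasi-polynomial for large $d$: there are a positive integer $g$ and polynomials $P_0,\dots,P_{g-1}$ such that, for $d\gg 0$, $\varphi_M(d)=P_i(d)$ where $d\equiv i\pmod g$. The index of regularity of $M$ is the least integer $r\geq 0$ such that for all $d\geq r$, $d\equiv i\pmod g$ implies $\varphi_M(d)=P_i(d)$. (For $M=K[t_1,\dots,t_s]/I_{\mathbb{T}}$, the function $\varphi_M(d)$ is constant for $d\gg 0$, equal to the number $(q-1)^{s-1}$ of points of $\mathbb{T}(w_1,\dots,w_s)$.) *)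

(* Defs.v *)
From mathcomp Require Import all_boot all_order all_algebra.
From mathcomp Require Import mpoly.
From Stdlib Require Import Classical.
Set Implicit Arguments.
Unset Strict Implicit.
Unset Printing Implicit Defensive.
Import GRing.Theory.
Local Open Scope ring_scope.

Section WeightedProjectiveSpace.
Local Open Scope quotient_scope.

Variables (K : finFieldType) (s : nat) (w : 'I_s -> nat).

Definition punctured : Type := {x : 'rV[K]_s | x != 0}.

Definition wscale (l : K) (x : 'rV[K]_s) : 'rV[K]_s :=
  \row_i (l ^+ w i * x 0 i).

Definition wproj_rel : rel punctured :=
  fun x y => [exists l : K, (l != 0) && (val y == wscale l (val x))].

Lemma wproj_rel_refl : reflexive wproj_rel.
Proof.
move=> x; apply/existsP; exists 1; rewrite oner_eq0 /=; apply/eqP/rowP=> i.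
by rewrite mxE expr1n mul1r.
Qed.

Lemma wproj_rel_sym : ssrbool.symmetric wproj_rel.
Proof.
suff H x y : wproj_rel x y -> wproj_rel y x by move=> x y; apply/idP/idP; exact: H.
case/existsP=> l /andP[l0 /eqP e]; apply/existsP; exists l^-1.
rewrite invr_eq0 l0 /=; apply/eqP/rowP=> i.
by rewrite e !mxE mulrA -exprMn mulVf // expr1n mul1r.
Qed.

Lemma wproj_rel_trans : transitive wproj_rel.
Proof.
move=> y x z /existsP[l /andP[l0 /eqP e]] /existsP[k /andP[k0 /eqP e']].
apply/existsP; exists (k * l); rewrite mulf_neq0 //=; apply/eqP/rowP=> i.
by rewrite e' !mxE e !mxE mulrA exprMn.
Qed.

Canonical wproj_equiv :=
  EquivRel wproj_rel wproj_rel_refl wproj_rel_sym wproj_rel_trans.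

Definition wproj : Type := {eq_quot wproj_rel}.

(* Independent of the chosen representative: see [wtorus_pi]. *)
Definition wtorus : {pred wproj} :=
  fun p => \prod_(i < s) val (repr p) 0 i != 0.

Lemma wtorus_pi (x : punctured) :
  (\pi_wproj x \in wtorus) = (\prod_(i < s) val x 0 i != 0).
Proof.
have : wproj_rel x (repr (\pi_wproj x)).
  by rewrite -[wproj_rel _ _]/(wproj_equiv _ _) -eqmodE reprK.
case/existsP=> l /andP[l0 /eqP e]; rewrite unfold_in /wtorus e.
under eq_bigr do rewrite mxE.
rewrite big_split /= mulf_eq0 negb_or.
by rewrite (_ : \prod_i _ != 0) //; apply/prodf_neq0=> i _; rewrite expf_neq0.
Qed.

Definition whomog (d : nat) (f : {mpoly K[s]}) : bool :=
  all (fun m : 'X_{1..s} => (\sum_(i < s) m i * w i)%N == d) (msupp f).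

Definition vanishes_on (X : {pred wproj}) (f : {mpoly K[s]}) : Prop :=
  forall x : punctured, \pi_wproj x \in X -> f.@[val x 0] = 0.

Definition generated_ideal (S : {mpoly K[s]} -> Prop) (f : {mpoly K[s]}) :
    Prop :=
  exists l : seq ({mpoly K[s]} * {mpoly K[s]}),
    (forall p, p \in l -> S p.2) /\ f = \sum_(p <- l) p.1 * p.2.

Definition vanishing_ideal (X : {pred wproj}) : {mpoly K[s]} -> Prop :=
  generated_ideal (fun f => (exists d, whomog d f) /\ vanishes_on X f).

End WeightedProjectiveSpace.

Arguments wtorus K {s} w.

(* For a subspace W of V, [quot_dim U W n] says that the image of U in V / W
   has a basis of n elements, namely the classes of the [e i]. *)
Definition quot_dim (K : fieldType) (V : lmodType K) (U W : V -> Prop)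
    (n : nat) : Prop :=
  exists e : 'I_n -> V,
    [/\ forall i, U (e i),
        forall c : 'I_n -> K, W (\sum_(i < n) c i *: e i) -> forall i, c i = 0
      & forall v, U v -> exists c : 'I_n -> K, W (v - \sum_(i < n) c i *: e i)].

(* phi d = dim_K (K[t_1,...,t_s] / I)_d, where the degree d part of the
   quotient is the image of the degree d part of the polynomial ring. *)
Definition is_hilbert_function (K : finFieldType) (s : nat) (w : 'I_s -> nat)
    (I : {mpoly K[s]} -> Prop) (phi : nat -> nat) : Prop :=
  forall d, quot_dim (fun f : {mpoly K[s]} => whomog w d f) I (phi d).

(* Values of the P i are compared in rat: the quasi-polynomial of an
   integer-valued function has rational coefficients. *)
Definition quasi_poly_from (phi : nat -> nat) (g : nat) (P : 'I_g -> {poly rat})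
    (r : nat) : Prop :=
  forall (d : nat) (i : 'I_g), (r <= d)%N -> (d = i %[mod g])%N ->
    (phi d)%:R = (P i).[d%:R].

Definition is_index_of_regularity (K : finFieldType) (s : nat)
    (w : 'I_s -> nat) (I : {mpoly K[s]} -> Prop) (r : nat) : Prop :=
  exists phi : nat -> nat, is_hilbert_function w I phi /\
  exists (g : nat) (P : 'I_g -> {poly rat}),
    [/\ (0 < g)%N, quasi_poly_from phi P r
      & forall r', quasi_poly_from phi P r' -> (r <= r')%N].

Definition in_semigroup (s : nat) (w : 'I_s -> nat) (n : nat) : Prop :=
  exists a : 'I_s -> nat, n = (\sum_(i < s) a i * w i)%N.

Definition is_frobenius_number (s : nat) (w : 'I_s -> nat) (g : int) : Prop :=
  (exists n : nat, [/\ g = n%:Z, ~ in_semigroup w n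
     & forall m, ~ in_semigroup w m -> (m <= n)%N])
  \/ ((forall n, in_semigroup w n) /\ g = -1).

Lemma frobenius_number_exists (s : nat) (w : 'I_s -> nat) :
  \big[gcdn/0%N]_(i < s) w i = 1%N -> exists g, is_frobenius_number w g.
Proof.
move=> w1.
have QD m n : in_semigroup w m -> in_semigroup w n -> in_semigroup w (m + n).
  case=> a -> [b ->]; exists (fun i => a i + b i)%N.
  by rewrite -big_split; apply: eq_bigr => i _; rewrite mulnDl.
have Q0 : in_semigroup w 0 by exists (fun=> 0%N); rewrite big1.
have QM k n : in_semigroup w n -> in_semigroup w (k * n).
  by move=> Qn; elim: k => // k IH; rewrite mulSn; apply: QD.
have Qw i : in_semigroup w (w i).
  exists (fun j => (j == i) : nat); rewrite (bigD1 i) //= eqxx mul1n.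
  by rewrite big1 ?addn0 // => j /negPf->.
have [b [Qb QSb]] : exists b, in_semigroup w b /\ in_semigroup w (b + 1).
  rewrite -w1; elim/big_rec: _ => [|i g _ [b [Qb Qbg]]]; first by exists 0%N.
  have [wi0|wi0] := posnP (w i); first by exists b; rewrite wi0 gcd0n.
  case: (egcdnP g wi0) => u v e _; exists (v * (b + g))%N.
  split; first exact: QM.
  have -> : (v * (b + g) + gcdn (w i) g = v * b + u * w i)%N.
    by rewrite e mulnDr addnA.
  by apply: QD; apply: QM.
have [N QN] : exists N, forall n, (N <= n)%N -> in_semigroup w n.
  exists (b * b)%N => n le_n; have [b0|b0] := posnP b.
    by rewrite -[n]muln1; apply: QM; rewrite b0 in QSb.
  have le_r : (n %% b <= n %/ b)%N.
    by apply: (leq_trans (ltnW (ltn_pmod _ b0))); rewrite leq_divRL.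
  suff -> : n = ((n %/ b - n %% b) * b + n %% b * (b + 1))%N.
    by apply: QD; apply: QM.
  by rewrite mulnDr muln1 addnA -mulnDl subnK // -divn_eq.
elim: N QN => [|N IH] QN; first by exists (-1); right; split=> // n; apply: QN.
have [QN'|nQN] := classic (in_semigroup w N).
  by apply: IH => n; rewrite leq_eqVlt => /orP[/eqP<-|/QN].
exists N%:Z; left; exists N; split=> // m nQm; rewrite leqNgt.
by apply/negP=> /QN.
Qed.

(* Main.v *)
(* Let G be the group of points of K^s with nonzero coordinates. On G a monomial
   t^a depends only on a modulo q - 1, and monomials with distinct residue
   vectors are linearly independent, by orthogonality of the characters of G.
   Hence the Hilbert function at d counts the vectors b with entries in [0, q-2]
   such that d = w.b + (q-1) n for some n in Q. It is bounded by the number of b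
   with w.b = d mod q-1, and the bound is attained for all
   d >= (q-2) (w_1 + ... + w_s) + (q-1) g_Q + 1; in degree one less, the vector
   b = (q-2, ..., q-2) forces n = g_Q, which is not in Q. *)
Require Import Defs.
From mathcomp Require Import all_boot all_order all_algebra all_field.
From mathcomp Require Import mpoly zify ring.
From Stdlib Require Import Classical.
Set Implicit Arguments.
Unset Strict Implicit.
Unset Printing Implicit Defensive.
Import Order.TTheory GRing.Theory Num.Theory.
Local Open Scope ring_scope.

(** * Power sums over a finite field and over its torus *)

Lemma card_finField_pred_gt0 (K : finFieldType) : (0 < #|K|.-1)%N.
Proof. by have := finNzRing_gt1 K; case: #|K| => [|[]]. Qed.

Lemma finField_expf_pred (K : finFieldType) (x : K) :
  x != 0 -> x ^+ #|K|.-1 = 1.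
Proof.
move=> x0; apply: (mulfI x0); rewrite -exprS mulr1 prednK ?expf_card //.
exact: ltnW (finNzRing_gt1 K).
Qed.

Lemma finField_expf_mod (K : finFieldType) (x : K) (a b : nat) :
  x != 0 -> (a = b %[mod #|K|.-1])%N -> x ^+ a = x ^+ b.
Proof.
move=> x0 eab; rewrite (divn_eq a #|K|.-1) (divn_eq b #|K|.-1) eab.
by rewrite !exprD !(mulnC _ #|K|.-1) !exprM finField_expf_pred // !expr1n.
Qed.

(** When q - 1 divides k every term is 1 and the sum is -1. Otherwise some nonzero y has
    [y ^+ k != 1], and the substitution x -> y x multiplies the sum by [y ^+ k] without changing
    it. *)
Lemma finField_power_sum_eq0 (K : finFieldType) (k : nat) :
  (\sum_(x : K | x != 0) x ^+ k == 0) = ~~ (#|K|.-1 %| k)%N.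
Proof.
set m := #|K|.-1; set S := \sum_(x | _) _.
have [mk|mk] /= := boolP (m %| k)%N.
  have S1 : S = \sum_(x : K | x != 0) 1.
    apply: eq_bigr => x x0; rewrite -[RHS](expr0 x).
    by apply: finField_expf_mod => //; rewrite mod0n; apply/eqP.
  (* The translation x -> x + 1 permutes K, so adding [\sum_x 1] leaves [\sum_x x] unchanged. *)
  have q0 : \sum_(x : K) 1 = 0 :> K.
    apply: (addrI (\sum_(x : K) x)); rewrite addr0 -big_split /=.
    by rewrite [RHS](reindex_inj (addIr 1)).
  move: q0; rewrite (bigD1 0) //= -S1 => /eqP; rewrite addrC addr_eq0 => /eqP->.
  by rewrite oppr_eq0 oner_eq0.
have k0 : (0 < k %% m)%N by rewrite lt0n.
(* [p] is nonzero of degree less than m, so the m nonzero elements of K cannot all be roots. *)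
pose p : {poly K} := 'X^(k %% m) - 1.
have sp : size p = (k %% m).+1 by rewrite size_Xn_sub_1.
have [y y0 yk] : exists2 y : K, y != 0 & y ^+ k != 1.
  apply/exists_inP; apply: contraT; rewrite negb_exists_in => /forall_inP h.
  have : (size (enum [pred x : K | x != 0%R]) < size p)%N.
    apply: max_poly_roots; first by rewrite -size_poly_eq0 sp.
      apply/allP => x; rewrite mem_enum inE => x0.
      rewrite rootE !hornerE subr_eq0.
      rewrite (@finField_expf_mod K x _ k) ?modn_mod //.
      by have := h x x0; rewrite negbK.
    exact: enum_uniq.
  rewrite sp -cardE (eq_card (B := predC1 (0 : K))) // cardC1 ltnS leqNgt.
  by rewrite ltn_pmod // card_finField_pred_gt0.
have yS : y ^+ k * S = S.
  rewrite mulr_sumr [RHS](reindex_inj (mulfI y0)) /=.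
  apply: eq_big => [x|x _]; last by rewrite exprMn.
  by rewrite mulf_eq0 negb_or y0.
have /eqP : (y ^+ k - 1) * S = 0 by rewrite mulrBl yS mul1r subrr.
by rewrite mulf_eq0 subr_eq0 (negPf yk).
Qed.

(** The sum factors into one power sum per coordinate. This is the orthogonality of characters used
    for linear independence. *)
Lemma torus_monomial_sum_eq0 (K : finFieldType) (s : nat) (k : 'I_s -> nat) :
  (\sum_(x in ffun_on [pred x : K | x != 0]) \prod_(i < s) x i ^+ k i == 0)
  = ~~ [forall i, (#|K|.-1 %| k i)%N].
Proof.
rewrite -(bigA_distr_big _ (fun i x => x ^+ k i)) /=.
rewrite negb_forall; apply/prodf_eq0/existsP => [[i _]|[i hi]].
  by rewrite finField_power_sum_eq0; exists i.
by exists i => //; rewrite finField_power_sum_eq0.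
Qed.

(** * The vanishing ideal of the torus and its Hilbert function *)

Lemma vanishes_on_wtorusP (K : finFieldType) (s : nat) (w : 'I_s -> nat)
    (f : {mpoly K[s]}) : (0 < s)%N ->
  vanishes_on (wtorus K w) f <->
  (forall x : 'I_s -> K, (forall i, x i != 0) -> f.@[x] = 0).
Proof.
move=> s0; split=> [fX x x0|fX x]; last first.
  by rewrite wtorus_pi => /prodf_neq0 x0; apply: fX => i; apply: x0.
have r0 : \row_i x i != 0.
  apply: contraTneq (x0 (Ordinal s0)) => /rowP/(_ (Ordinal s0)).
  by rewrite !mxE => ->; rewrite eqxx.
have -> : f.@[x] = f.@[val (exist (fun r => r != 0) _ r0 : punctured K s) 0].
  rewrite !mevalE; apply: eq_bigr => a _; congr (_ * _).
  by apply: eq_bigr => i _ /=; rewrite mxE.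
apply: fX; rewrite wtorus_pi; apply/prodf_neq0 => i _ /=.
by rewrite mxE.
Qed.

Lemma vanishing_ideal_vanishes (K : finFieldType) (s : nat) (w : 'I_s -> nat)
    (X : {pred wproj K w}) (f : {mpoly K[s]}) :
  vanishing_ideal X f -> vanishes_on X f.
Proof.
case=> l [hl ->] x xX; rewrite raddf_sum big_seq big1 //=.
by move=> p /hl[_ /(_ x xX) p0]; rewrite mevalM p0 mulr0.
Qed.

Lemma homog_vanishing_ideal (K : finFieldType) (s : nat) (w : 'I_s -> nat)
    (X : {pred wproj K w}) (d : nat) (f : {mpoly K[s]}) :
  whomog w d f -> vanishes_on X f -> vanishing_ideal X f.
Proof.
move=> fd fX; exists [:: (1, f)]; split; last by rewrite big_seq1 mul1r.
by move=> p; rewrite inE => /eqP->; split=> //; exists d.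
Qed.

Lemma whomogP (K : finFieldType) (s : nat) (w : 'I_s -> nat) (d : nat)
    (f : {mpoly K[s]}) :
  reflect (forall a : 'X_{1..s}, f@_a != 0 -> (\sum_(i < s) a i * w i)%N = d)
    (whomog w d f).
Proof.
apply: (iffP allP) => h a; first by rewrite -mcoeff_msupp => /h/eqP.
by rewrite mcoeff_msupp => /h/eqP.
Qed.

(* The residue vector b is that of the exponent of some monomial of degree d;
   since the weights are positive, all exponents are then at most d. *)
Definition attained (m s : nat) (w : 'I_s -> nat) (d : nat)
    (b : {ffun 'I_s -> 'I_m}) : bool :=
  [exists a : {ffun 'I_s -> 'I_d.+1},
    ((\sum_(i < s) a i * w i)%N == d) && [forall i, (a i == b i %[mod m])%N]].

Lemma attainedP (m s : nat) (w : 'I_s -> nat) (d : nat)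
    (b : {ffun 'I_s -> 'I_m}) : (forall i, (0 < w i)%N) ->
  reflect (exists2 a : 'X_{1..s}, (\sum_(i < s) a i * w i)%N = d
             & forall i, (a i = b i %[mod m])%N) (attained w d b).
Proof.
move=> w0; apply: (iffP existsP) => [[a /andP[/eqP ad /forallP ab]]|[a ad ab]].
  exists [multinom (a i : nat) | i < s] => [|i]; last by rewrite mnmE; apply/eqP.
  by rewrite -[RHS]ad; apply: eq_bigr => i _; rewrite mnmE.
have lead i : (a i < d.+1)%N.
  rewrite ltnS -ad (bigD1 i) //=; apply: leq_trans (leq_addr _ _).
  exact: leq_pmulr.
exists [ffun i => Ordinal (lead i)]; apply/andP; split.
  by apply/eqP; rewrite -[RHS]ad; apply: eq_bigr => i _; rewrite ffunE.
by apply/forallP => i; rewrite ffunE /=; apply/eqP.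
Qed.

(** A basis is given by one monomial of degree d for each attained residue vector. *)
Lemma wtorus_hilbert_function (K : finFieldType) (s : nat) (w : 'I_s -> nat) :
  (0 < s)%N -> (forall i, (0 < w i)%N) ->
  is_hilbert_function w (vanishing_ideal (wtorus K w))
    (fun d => #|[set b : {ffun 'I_s -> 'I_(#|K|.-1)} | attained w d b]|).
Proof.
move=> s0 w0 d; set m := #|K|.-1; set B := [set b | _].
pose rep (j : 'I_(#|B|)) (a : 'X_{1..s}) := (\sum_(i < s) a i * w i)%N = d /\
  forall i, (a i = (enum_val j : {ffun 'I_s -> 'I_m}) i %[mod m])%N.
have [a aP] : exists a, forall j, rep j (a j).
  apply: (@fin_all_exists _ (fun=> 'X_{1..s}) rep) => j.
  have := enum_valP j; rewrite inE => /attainedP -/(_ w0)[a ad ab].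
  by exists a.
have aX j (x : 'I_s -> K) : (forall i, x i != 0) ->
    ('X_[a j]).@[x] = \prod_(i < s) x i ^+ (enum_val j : {ffun 'I_s -> 'I_m}) i.
  move=> x0; rewrite mevalX; apply: eq_bigr => i _.
  by apply: finField_expf_mod => //; case: (aP j).
exists (fun j => 'X_[a j]); split.
- move=> j; apply/whomogP => k; rewrite mcoeffX.
  by case: (eqVneq (a j) k) => [<- _|_]; [case: (aP j) | rewrite eqxx].
- move=> c /vanishing_ideal_vanishes/(vanishes_on_wtorusP _ _ s0) cX j.
  set b : {ffun 'I_s -> 'I_m} := enum_val j.
  pose T := [pred x : K | x != 0].
  (* The factor x^(m - b) stands for the inverse character x^(-b). *)
  have : \sum_(x in ffun_on T) (\sum_j c j *: 'X_[a j]).@[x : 'I_s -> K] *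
            \prod_i x i ^+ (m - b i) = 0.
    by rewrite big1 // => x /ffun_onP xT; rewrite cX ?mul0r.
  have -> : \sum_(x in ffun_on T) (\sum_j c j *: 'X_[a j]).@[x : 'I_s -> K] *
            \prod_i x i ^+ (m - b i) =
      \sum_j' c j' * \sum_(x in ffun_on T) \prod_i
         x i ^+ ((enum_val j' : {ffun 'I_s -> 'I_m}) i + (m - b i)).
    under [RHS]eq_bigr do rewrite mulr_sumr.
    rewrite exchange_big /=; apply: eq_bigr => x /ffun_onP xT.
    rewrite raddf_sum mulr_suml; apply: eq_bigr => j' _ /=.
    rewrite mevalZ aX // -mulrA -big_split /=; congr (_ * _).
    by apply: eq_bigr => i _; rewrite exprD.
  (* Only the term j' = j survives: its exponents are all m, so its character sum is nonzero and
     [c j] must be 0. *)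
  rewrite (bigD1 j) //= [X in _ + X]big1 ?addr0 => [|j' j'j].
    move/eqP; rewrite mulf_eq0 torus_monomial_sum_eq0.
    case/orP => [/eqP//|/negP[]]; apply/forallP => i.
    by rewrite subnKC // ltnW.
  apply/eqP; rewrite mulf_eq0 torus_monomial_sum_eq0; apply/orP; right.
  apply: contra j'j => /forallP h; apply/eqP/enum_val_inj/ffunP => i.
  apply: val_inj; have := h i; rewrite -/b -/m.
  move: (ltn_ord (b i)) (ltn_ord ((enum_val j' : {ffun 'I_s -> 'I_m}) i)) => /=.
  set u := nat_of_ord (b i); set v := nat_of_ord (fun_of_fin _ i).
  (* The multiple v + (m - u) of m lies strictly between 0 and 2m, hence equals m, and u = v. *)
  move=> um vm /dvdnP[k e]; have k1 : k = 1%N by nia.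
  by move: e; rewrite k1 -/u -/v; lia.
- move=> f /whomogP fd.
  pose cls (k : 'X_{1..s}) : {ffun 'I_s -> 'I_m} :=
    [ffun i => Ordinal (ltn_pmod (k i) (card_finField_pred_gt0 K))].
  (* Monomials of f in the same residue class agree on the torus, so their coefficients are
     collected on the chosen representative. The difference is homogeneous of degree d and vanishes
     on the torus. *)
  pose c (j : 'I_(#|B|)) := \sum_(k <- msupp f | cls k == enum_val j) f@_k.
  exists c; apply: (@homog_vanishing_ideal _ _ _ _ d).
    apply/whomogP => k; rewrite mcoeffB.
    have [->|/fd//] := eqVneq f@_k 0; rewrite sub0r oppr_eq0 raddf_sum /=.
    have [//|/eqP kd] := eqVneq (\sum_(i < s) k i * w i)%N d.
    rewrite big1 ?eqxx // => j _; rewrite mcoeffZ mcoeffX.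
    case: eqVneq => [e|]; rewrite ?mulr0 //.
    by case: kd; rewrite -e; case: (aP j).
  apply/vanishes_on_wtorusP => // x x0; rewrite mevalB.
  apply/eqP; rewrite subr_eq0; apply/eqP; rewrite [LHS]mevalE raddf_sum /=.
  under [RHS]eq_bigr => j _ do rewrite mevalZ aX // mulr_suml big_mkcond /=.
  rewrite exchange_big /=; apply: eq_big_seq => k.
  rewrite mcoeff_msupp => /fd kd.
  have kB : cls k \in B.
    rewrite inE; apply/attainedP => //; exists k => // i.
    by rewrite ffunE /= modn_mod.
  rewrite (bigD1 (enum_rank_in kB (cls k))) //= enum_rankK_in // eqxx.
  rewrite [X in _ + X]big1 ?addr0 => [|j jk].
    congr (_ * _); apply: eq_bigr => i _; rewrite ffunE /=.
    by apply: finField_expf_mod; rewrite ?modn_mod.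
  case: eqP => // e; case/eqP: jk; apply: enum_val_inj.
  by rewrite enum_rankK_in.
Qed.

(** Dividing each exponent by m leaves the remainders b, and the quotients are the coefficients of
    an element of the semigroup. *)
Lemma attainedE (m s : nat) (w : 'I_s -> nat) (d : nat)
    (b : {ffun 'I_s -> 'I_m}) : (forall i, (0 < w i)%N) ->
  attained w d b <->
  exists2 n, in_semigroup w n & d = (\sum_(i < s) b i * w i + m * n)%N.
Proof.
move=> w0; split=> [/attainedP-/(_ w0)[a <- ab]|[n [c ->] ->]].
  exists (\sum_(i < s) (a i %/ m) * w i)%N; first by exists (fun i => a i %/ m)%N.
  rewrite big_distrr -big_split; apply: eq_bigr => i _ /=.
  rewrite {1}(divn_eq (a i) m) ab modn_small //; lia.
apply/attainedP => //; exists [multinom (b i + m * c i)%N | i < s] => [|i].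
  rewrite big_distrr -big_split; apply: eq_bigr => i _ /=.
  by rewrite mnmE mulnDl mulnA.
by rewrite mnmE mulnC addnC modnMDl.
Qed.

Lemma attained_congr (m s : nat) (w : 'I_s -> nat) (d : nat)
    (b : {ffun 'I_s -> 'I_m}) : (forall i, (0 < w i)%N) ->
  attained w d b -> (d = \sum_(i < s) b i * w i %[mod m])%N.
Proof. by move=> w0 /attainedE-/(_ w0)[n _ ->]; rewrite addnC mulnC modnMDl. Qed.

(** * The Frobenius number and the index of regularity *)

Lemma frobenius_ge (s : nat) (w : 'I_s -> nat) (g : int) :
  is_frobenius_number w g -> -1 <= g.
Proof. by case=> [[n [-> _ _]]|[_ ->]]. Qed.

Lemma frobenius_gap (s : nat) (w : 'I_s -> nat) (g : int) (n : nat) :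
  is_frobenius_number w g -> n%:Z = g -> ~ in_semigroup w n.
Proof. by case=> [[k [-> nk _]] [->]|[_ ->]]. Qed.

Lemma frobenius_gt (s : nat) (w : 'I_s -> nat) (g : int) (n : nat) :
  is_frobenius_number w g -> g < n%:Z -> in_semigroup w n.
Proof.
case=> [[k [-> _ kP]] kn|[//]]; apply: NNPP => /kP; lia.
Qed.

Theorem corollary3p9 (K : finFieldType) (s : nat) (w : 'I_s -> nat) (gQ : int)
    (hs : (1 <= s)%N) (hw : forall i, (0 < w i)%N)
    (hgcd : \big[gcdn/0%N]_(i < s) w i = 1%N)
    (hgQ : is_frobenius_number w gQ) :
  exists2 r : nat,
    is_index_of_regularity w (vanishing_ideal (wtorus K w)) r
    & r%:Z = (#|K|%:Z - 2) * ((\sum_(i < s) w i)%N%:Z + gQ) + gQ + 1.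
Proof.
have q1 := finNzRing_gt1 K; have m0 := card_finField_pred_gt0 K.
have g1 := frobenius_ge hgQ.
set W := (\sum_(i < s) w i)%N; set m := #|K|.-1 in m0.
have qm : #|K|%:Z = m%:Z + 1 by rewrite /m; lia.
have W0 : (0 < W)%N by rewrite /W (bigD1 (Ordinal hs)) //= addn_gt0 hw.
set rz := (_ + 1 : int).
have rE : rz = (m%:Z - 1) * W%:Z + m%:Z * gQ + 1 by rewrite /rz qm; ring.
(* The smallest case [gQ] = -1 gives (m - 1)(W - 1), nonnegative because W >= 1. *)
have rz0 : 0 <= rz by rewrite rE; nia.
have [r rr] : exists r : nat, r%:Z = rz by exists (absz rz); rewrite gez0_abs.
exists r => //.
pose S (i : nat) := [set b : {ffun 'I_s -> 'I_m} |
  (i == \sum_(i < s) b i * w i %[mod m])%N].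
exists (fun d => #|[set b : {ffun 'I_s -> 'I_m} | attained w d b]|); split.
  exact: wtorus_hilbert_function.
(* Each #|S i| is (q-1)^(s-1), but period q - 1 makes that count unnecessary. *)
exists m, (fun i => #|S i|%:R%:P); split=> // [d i le_rd di|r' hr'].
  rewrite hornerC; congr (#|pred_of_set _|%:R); apply/setP => b; rewrite !inE -di.
  apply/idP/eqP => [/(attained_congr hw)//|/eqP db].
  apply/(attainedE d b hw).
  have bW : (\sum_(i < s) b i * w i <= m.-1 * W)%N.
    rewrite /W big_distrr; apply: leq_sum => j _ /=.
    by rewrite leq_mul2r -ltnS prednK // ltn_ord orbT.
  move: db bW; set u := (\sum_(i < s) b i * w i)%N => db bW.
  (* If d < u, the congruence gives u >= d + m; but d + m >= r + m > (m - 1) W >= u, because [gQ] >=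
     -1. *)
  have lt_ud : (u <= d)%N.
    rewrite leqNgt; apply/negP => du; move: db; rewrite eq_sym eqn_mod_dvd.
      by move=> /dvdnP[[|k] ek]; nia.
    exact: ltnW.
  move: db; rewrite eqn_mod_dvd // => /dvdnP[n dn].
  exists n; last lia.
  (* Here m n = d - u >= r - (m - 1) W = m gQ + 1, so n > gQ. *)
  apply: (frobenius_gt hgQ); nia.
(* If some r' < r worked, the count in degree r - 1 would equal that of its whole congruence class,
   so every b in that class would be attained. *)
rewrite leqNgt; apply/negP => r'r.
(* The shift to gQ + 1, with m added on the left of [dE], keeps the identity in [nat] even for [gQ]
   = -1. As r' < r, r is positive and [r.-1] is a true predecessor. *)
have [k kE] : exists k : nat, k%:Z = gQ + 1 by exists (absz (gQ + 1)); lia.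
have dE : (r.-1 + m = m.-1 * W + k * m)%N by nia.
set d := r.-1 in dE.
have le_r'd : (r' <= d)%N by rewrite /d; lia.
have := hr' d (Ordinal (ltn_pmod d m0)) le_r'd (esym (modn_mod d m)).
rewrite hornerC => /eqP; rewrite eqr_nat => /eqP cardE.
have sub : [set b : {ffun 'I_s -> 'I_m} | attained w d b] \subset S (d %% m)%N.
  by apply/subsetP => b; rewrite !inE modn_mod => /(attained_congr hw)/eqP.
have last_lt : (m.-1 < m)%N by rewrite prednK.
have bE : (\sum_(i < s) [ffun=> Ordinal last_lt] i * w i = m.-1 * W)%N.
  by rewrite /W big_distrr; apply: eq_bigr => i _; rewrite ffunE.
have : [ffun=> Ordinal last_lt] \in S (d %% m)%N.
  by rewrite inE bE modn_mod -(modnDr d) dE addnC modnMDl.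
rewrite -(subset_cardP cardE sub) inE => /(attainedE _ _ hw)[n nQ].
rewrite bE => dn; apply: (frobenius_gap hgQ _ nQ).
have /eqP : (n.+1 * m = k * m)%N by move: dE; rewrite dn mulSn (mulnC m); lia.
by rewrite eqn_pmul2r // => /eqP nk; lia.
Qed.
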